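(* Over the binary field $\mathbb{F}_2$, there are no self-dual polycyclic codes, no self-orthogonal polycyclic codes, and no nontrivial dual-containing polycyclic codes associated with trinomials. That is, let $0<i<n$ be integers and let $C$ be a polycyclic code of length $n$ over $\mathbb{F}_2$ associated with the trinomial $x^n+x^i+1$. Then: (1) $C$ is not self-dual; (2) $C$ is not self-orthogonal; (3) if $C\neq\mathbb{F}_2^n$, then $C$ is not dual-containing.
   Context: Vectors $(c_0,\dots,c_{n-1})\in\mathbb{F}_2^n$ are identified with polynomials $c_0+c_1x+\cdots+c_{n-1}x^{n-1}$. For a monic polynomial $f(x)\in\mathbb{F}_2[x]$ of degree $n$, a linear code $C\subseteq\mathbb{F}_2^n$ is a polycyclic code associated with $f(x)$ if, under this identification, it is an ideal of $\mathbb{F}_2[x]/\langle f(x)\rangle$ (elements being represented by their remainders of degree less than $n$). Such a code is generated by a monic divisor $g(x)$ of $f(x)$, called its generator polynomial. The dual $C^\perp$ is the set of vectors orthogonal to every codeword of $C$ under the Euclidean inner product. $C$ is self-dual if $C=C^\perp$, self-orthogonal if $C\subseteq C^\perp$, and dual-containing if $C^\perp\subseteq C$. The trivial dual-containing code is $C=\mathbb{F}_2^n$ (generator polynomial $1$).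
   Formalization: Claim (2) is stated only for C ≠ {0}: the zero code, the ideal generated by the trinomial itself, is polycyclic and is trivially self-orthogonal, so the claim as written fails for it. *)

(* Defs.v *)
From HB Require Import structures.
From mathcomp Require Import all_boot all_order all_algebra.

Set Implicit Arguments.
Unset Strict Implicit.
Unset Printing Implicit Defensive.

Import GRing.Theory.
Local Open Scope ring_scope.

(* The library's [idealr_closed] describes proper ideals only (it demands
   [1 \notin S]); the whole ring has to be allowed here, since it corresponds
   to the trivial code F^n. *)
Definition ideal_closed (R : comNzRingType) (S : {pred R}) : Prop :=
  zmod_closed S /\ (forall a u : R, u \in S -> a * u \in S).

Section Codes.

Variables (F : finFieldType) (n : nat).
Implicit Types (C : {vspace 'rV[F]_n}) (f : {poly F}) (u v : 'rV[F]_n).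

(* [poly_rV q] is the vector (c_0, ..., c_(n-1)) of coefficients of q.
   [{poly %/ f}] consists of the remainders modulo f, of degree less than n;
   it is a genuine quotient by f because f is monic of degree n, for n > 0
   (for n = 0 the library replaces f by 'X, but then 'rV_0 is trivial). *)
Definition polycyclic f C : Prop :=
  [/\ f \is monic, size f = n.+1 &
      ideal_closed [pred q : {poly %/ f} | poly_rV (val q) \in C]].

Definition euclidean_dot u v : F := \sum_(j < n) u 0 j * v 0 j.

Definition dual_code C : {pred 'rV[F]_n} :=
  [pred v | [forall c in C, euclidean_dot v c == 0]].

Definition self_dual C : Prop := C =i dual_code C.

Definition self_orthogonal C : Prop := {subset C <= dual_code C}.

Definition dual_containing C : Prop := {subset dual_code C <= C}.

End Codes.

(* Main.v *)
Require Import Defs.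
From mathcomp Require Import all_boot all_order all_algebra.

Import GRing.Theory.
Local Open Scope ring_scope.

(** Let T be multiplication by x on F_2^n and f = x^n + x^i + 1.  Over F_2 the
    scalar <u, u> is the parity u(1), and f(1) = 1 gives
    <Tu, Tu> = <u, u> - u_(n-1).  So every word of a self-orthogonal code has
    last coordinate 0; the code being stable under T, which then acts as a pure
    shift, all the other coordinates vanish as well.
    Dually, the dual code D of C is stable under the transpose S of T, and
    <Su, Su> = <u, u> - u_i.  If D is contained in C it is self-orthogonal, so
    u_i = 0 on D; since (Su)_j = u_(j+1) for j < n-1, the coordinates above i
    vanish, then u_0, because (Su)_(n-1) = u_0 + u_i, then all the others.
    Hence D = 0 and C is the whole space. *)

Section Duality.

Variables (F : finFieldType) (n : nat).
Implicit Types (u v : 'rV[F]_n) (C : {vspace 'rV[F]_n}).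

Lemma euclidean_dot_mulmx u v : euclidean_dot u v = (u *m v^T) 0 0.
Proof. by rewrite mxE; apply: eq_bigr => j _; rewrite mxE. Qed.

Lemma dual_codeP C v :
  reflect (forall c, c \in C -> euclidean_dot v c = 0) (v \in dual_code C).
Proof. exact: 'forall_in_eqP. Qed.

(** A basis of C with fewer than n vectors forms a matrix [A] of rank below n, so [A^T] has a
    nonzero left kernel vector, which lies in the dual. *)
Lemma dual_code_eq0_full C :
  (forall v, v \in dual_code C -> v = 0) -> C = fullv.
Proof.
move=> dual0; apply/eqP; rewrite eqEdim subvf dimvf dim_matrix mul1r /=.
rewrite leqNgt; apply/negP => ltCn.
pose A := \matrix_(k < \dim C) (vbasis C)`_k.
have /rowV0Pn[v /sub_kermxP vA]: kermx A^T != 0.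
  rewrite kermx_eq0 /row_free mxrank_tr neq_ltn.
  by rewrite (leq_ltn_trans (rank_leq_row A)).
case/eqP; apply: dual0; apply/dual_codeP => c /coord_vbasis->.
rewrite euclidean_dot_mulmx linear_sum mulmx_sumr summxE big1 // => k _.
rewrite linearZ -scalemxAr mxE -euclidean_dot_mulmx.
suff -> : euclidean_dot v (vbasis C)`_k = (v *m A^T) 0 k.
  by rewrite vA mxE mulr0.
by rewrite mxE; apply: eq_bigr => j _; rewrite !mxE.
Qed.

End Duality.

Section Shift.

Variables (F : finFieldType) (m : nat) (f : {poly F}).
Implicit Types (u v : 'rV[F]_m.+1) (C : {vspace 'rV[F]_m.+1}).

(** The map T: for f monic of degree m+1, subtracting the top coefficient times f is the whole
    reduction modulo f. *)
Definition polycyclic_shift u : 'rV[F]_m.+1 :=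
  poly_rV ('X * rVpoly u - (rVpoly u)`_m *: f).

(** The map S: entry j pairs u with T e_j, which is e_(j+1) for j < m and, for j = m, minus the part
    of f below its leading term. *)
Definition dual_shift u : 'rV[F]_m.+1 :=
  \row_j (if j == m :> nat then - \sum_(k < m.+1) u 0 k * f`_k
          else (rVpoly u)`_j.+1).

Hypotheses (f_monic : f \is monic) (f_size : size f = m.+2).

Lemma rVpoly_polycyclic_shift u :
  rVpoly (polycyclic_shift u) = 'X * rVpoly u - (rVpoly u)`_m *: f.
Proof.
apply/poly_rV_K/leq_sizeP => j; rewrite leq_eqVlt => /predU1P[<-|lt_mj].
  rewrite coefB coefZ coefXM /= -[X in f`_X]/(m.+2.-1) -f_size.
  by rewrite -lead_coefE (eqP f_monic) mulr1 subrr.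
rewrite coefB coefZ coefXM (@nth_default _ _ f) ?f_size // mulr0 subr0.
case: j lt_mj => //= j lt_mj.
by rewrite nth_default // (leq_trans (size_poly _ _)).
Qed.

Lemma polycyclic_shift_closed C u :
  polycyclic f C -> u \in C -> polycyclic_shift u \in C.
Proof.
move=> [_ _ [_ mulC]] uC.
(* The quotient ring is built modulo [mk_monic f], which is f itself for f monic of positive
   degree. *)
have fE : mk_monic f = f by rewrite /mk_monic f_monic f_size.
set P := [pred q | _] in mulC.
have inP v : (in_qpoly f (rVpoly v) \in P) = (v \in C).
  by rewrite inE [\val _]in_qpoly_small ?rVpolyK // fE f_size ltnS size_poly.
rewrite -inP.
suff -> : in_qpoly f (rVpoly (polycyclic_shift u)) =
          in_qpoly f 'X * in_qpoly f (rVpoly u) by apply: mulC; rewrite inP.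
rewrite rVpoly_polycyclic_shift -scaleNr in_qpolyD in_qpolyZ -in_qpolyM.
suff -> : in_qpoly f f = 0 by rewrite scaler0 addr0.
by apply: val_inj; rewrite /= fE Pdiv.RingMonic.rmodpp.
Qed.

Lemma dual_shift_adjoint u v :
  euclidean_dot (dual_shift u) v = euclidean_dot u (polycyclic_shift v).
Proof.
have TvE j : polycyclic_shift v 0 j =
    (if j == 0%N :> nat then 0 else (rVpoly v)`_j.-1) - (rVpoly v)`_m * f`_j.
  by rewrite -coef_rVpoly_ord rVpoly_polycyclic_shift coefB coefZ coefXM.
rewrite /euclidean_dot.
under [RHS]eq_bigr => j _ do rewrite TvE mulrBr mulrCA.
(* The term j = m on the left carries the coefficients of f, and the term j = 0 on the right
   vanishes; the rest agrees after reindexing. *)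
rewrite sumrB -mulr_sumr [LHS]big_ord_recr [X in _ = X - _]big_ord_recl /=.
rewrite mxE eqxx mulr0 add0r mulNr mulrC -coef_rVpoly_ord.
congr (_ - _); apply: eq_bigr => j _.
by rewrite mxE /= ltn_eqF // -!coef_rVpoly_ord add0n.
Qed.

Lemma dual_shift_closed C u :
  polycyclic f C -> u \in dual_code C -> dual_shift u \in dual_code C.
Proof.
move=> polyC /dual_codeP uC; apply/dual_codeP => c cC.
by rewrite dual_shift_adjoint uC // polycyclic_shift_closed.
Qed.

Lemma polycyclic_last_coef_eq0 C :
  polycyclic f C -> (forall u, u \in C -> (rVpoly u)`_m = 0) -> C = 0%VS.
Proof.
move=> polyC last0; apply/eqP; rewrite -subv0; apply/subvP => u uC.
rewrite memv0; apply/eqP/rowP => j; rewrite mxE -coef_rVpoly_ord.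
suff coef0 k : (k <= m)%N -> forall v, v \in C -> (rVpoly v)`_(m - k) = 0.
  have le_jm : (j <= m)%N by rewrite -ltnS.
  by rewrite -(subKn le_jm) coef0 // leq_subr.
elim: k => [|k IHk] lt_km v vC; first by rewrite subn0 last0.
(* Since the top coefficient of v is 0, T v is x v, whose entry m-k is entry m-k-1 of v. *)
have := IHk (ltnW lt_km) _ (polycyclic_shift_closed _ _ polyC vC).
rewrite rVpoly_polycyclic_shift last0 // scale0r subr0 coefXM.
by rewrite subn_eq0 leqNgt lt_km /= -subnS.
Qed.

End Shift.

Lemma mulF2 (a : 'F_2) : a * a = a.
Proof. by apply: val_inj; case: a => [[|[|a]] lt_a2]. Qed.

Lemma euclidean_dotF2 (n : nat) (u : 'rV['F_2]_n) :
  euclidean_dot u u = (rVpoly u).[1].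
Proof.
rewrite (@horner_coef_wide _ n) ?size_poly //; apply: eq_bigr => j _.
by rewrite mulF2 expr1n mulr1 coef_rVpoly_ord.
Qed.

Lemma self_orthogonal_polycyclicF2 (m : nat) (f : {poly 'F_2})
    (C : {vspace 'rV['F_2]_m.+1}) :
  f.[1] = 1 -> polycyclic f C -> self_orthogonal C -> C = 0%VS.
Proof.
move=> f1 polyC orthC; have [f_monic f_size _] := polyC.
have parity0 u : u \in C -> (rVpoly u).[1] = 0.
  by move=> /[dup] /orthC/dual_codeP-orthu uC; rewrite -euclidean_dotF2 orthu.
apply: (polycyclic_last_coef_eq0 _ _ _ f_monic f_size _ polyC) => u uC.
have := parity0 _ (polycyclic_shift_closed _ _ _ f_monic f_size _ _ polyC uC).
rewrite rVpoly_polycyclic_shift // hornerD hornerN hornerM hornerX hornerZ.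
by rewrite parity0 // f1 mul1r mulr1 sub0r => /eqP; rewrite oppr_eq0 => /eqP.
Qed.

Section Trinomial.

Variables (m : nat) (i : 'I_m.+1).
Implicit Types (u : 'rV['F_2]_m.+1) (C : {vspace 'rV['F_2]_m.+1}).

Local Notation f := ('X^(m.+1) + 'X^i + 1 : {poly 'F_2}).

Lemma trinomial_horner1 : f.[1] = 1.
Proof. by rewrite !hornerE !expr1n; apply: val_inj. Qed.

Lemma dual_shift_trinomial_last u :
  dual_shift _ m f u 0 ord_max = - (u 0 i + u 0 0).
Proof.
(* The coefficients of x^i and 1 are Kronecker deltas, so each sum picks out one entry of u. *)
have sum_delta k : \sum_(j < m.+1) u 0 j * (j == k :> nat)%:R = (rVpoly u)`_k.
  rewrite coef_rVpoly; case: insubP => [l _ <-|].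
    rewrite (bigD1 l) //= eqxx mulr1 big1 ?addr0 // => j /negPf.
    by rewrite -val_eqE /= => ->; rewrite mulr0.
  rewrite -leqNgt => le_mk; rewrite big1 // => j _.
  by rewrite ltn_eqF ?mulr0 // (leq_trans _ le_mk).
rewrite mxE eqxx -!coef_rVpoly_ord -!sum_delta -big_split /=; congr (- _).
apply: eq_bigr => j _.
by rewrite !coefE (ltn_eqF (ltn_ord j)) add0r mulrDr.
Qed.

(** Over F_2 the form is the sum of the entries; S rotates u cyclically and adds u_i to the last
    entry. *)
Lemma dual_shift_trinomial_dot u :
  euclidean_dot (dual_shift _ m f u) (dual_shift _ m f u)
  = euclidean_dot u u - u 0 i.
Proof.
rewrite /euclidean_dot; under eq_bigr => j _ do rewrite mulF2.
under [in RHS]eq_bigr => j _ do rewrite mulF2.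
rewrite big_ord_recr /= dual_shift_trinomial_last big_ord_recl.
have -> : \sum_(j < m) dual_shift _ m f u 0 (widen_ord (leqnSn m) j)
        = \sum_(j < m) u 0 (lift ord0 j).
  by apply: eq_bigr => j _; rewrite mxE /= ltn_eqF // -coef_rVpoly_ord.
have oppF2 (a : 'F_2) : - a = a by apply: val_inj; case: a => [[|[|a]] lt_a2].
by rewrite !oppF2 addrCA addrC [u 0 ord0 + _]addrC.
Qed.

Lemma dual_trinomial_eq0 C :
  polycyclic f C -> (forall u, u \in dual_code C -> u 0 i = 0) ->
  forall u, u \in dual_code C -> u = 0.
Proof.
move=> polyC coefi0; have [f_monic f_size _] := polyC.
have stab u := dual_shift_closed _ _ _ f_monic f_size _ u polyC.
have shiftE u k : (k < m)%N ->
    (rVpoly (dual_shift _ m f u))`_k = (rVpoly u)`_k.+1.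
  move=> lt_km; rewrite -[k]/(val (Ordinal (ltnW lt_km : (k < m.+1)%N))).
  by rewrite coef_rVpoly_ord mxE /= ltn_eqF.
have high0 k : (i + k <= m)%N ->
    forall u, u \in dual_code C -> (rVpoly u)`_(i + k) = 0.
  elim: k => [|k IHk] le_ikm u uC; first by
    rewrite addn0 coef_rVpoly_ord coefi0.
  rewrite addnS in le_ikm *.
  by rewrite -shiftE // IHk ?stab // ltnW.
have low0 k : (k <= m)%N -> forall u, u \in dual_code C -> (rVpoly u)`_k = 0.
  elim: k => [_ u uC|k IHk lt_km u uC]; last first.
    by rewrite -shiftE // IHk ?stab // ltnW.
  have le_im : (i <= m)%N by rewrite -ltnS.
  (* Entry m = i + (m - i) of S u vanishes by [high0]; it is u_0 + u_i up to sign, and u_i = 0. *)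
  have := high0 (m - i)%N _ _ (stab u uC); rewrite subnKC // => /(_ (leqnn m)).
  rewrite -[m in _`_m]/(val (ord_max : 'I_m.+1)) coef_rVpoly_ord.
  rewrite dual_shift_trinomial_last coefi0 // add0r => /eqP.
  by rewrite oppr_eq0 -coef_rVpoly_ord => /eqP.
move=> u uC; apply/rowP => j; rewrite mxE -coef_rVpoly_ord low0 //.
by rewrite -ltnS.
Qed.

Lemma dual_containing_trinomial C :
  polycyclic f C -> dual_containing C -> C = fullv.
Proof.
move=> polyC dualC; have [f_monic f_size _] := polyC.
have dot0 u : u \in dual_code C -> euclidean_dot u u = 0.
  by move=> uC; apply: (dual_codeP _ _ _ _ uC); apply: dualC.
apply/dual_code_eq0_full/(dual_trinomial_eq0 _ polyC) => u uC.
have := dot0 _ (dual_shift_closed _ _ _ f_monic f_size _ _ polyC uC).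
rewrite dual_shift_trinomial_dot dot0 // sub0r => /eqP.
by rewrite oppr_eq0 => /eqP.
Qed.

End Trinomial.

(* The zero code is an ideal and is trivially self-orthogonal, so it is
   excluded from the second claim. *)
Theorem theorem6p1 (n i : nat) (C : {vspace 'rV['F_2]_n}) :
  (0 < i)%N -> (i < n)%N ->
  polycyclic ('X^n + 'X^i + 1) C ->
  [/\ ~ self_dual C,
      (C <> 0%VS -> ~ self_orthogonal C) &
      (C <> fullv -> ~ dual_containing C)].
Proof.
case: n C => // m C _ lt_im polyC.
have f1 := trinomial_horner1 _ (Ordinal lt_im).
have orth0 := self_orthogonal_polycyclicF2 _ _ _ f1 polyC.
have contT := dual_containing_trinomial _ (Ordinal lt_im) _ polyC.
split=> [dualC | C0 /orth0// | CT /contT//].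
(* Self-duality gives both inclusions, so C would be both zero and full, in dimension m+1 > 0. *)
have C0 : C = 0%VS by apply: orth0 => u; rewrite dualC.
have CT : C = fullv by apply: contT => u; rewrite dualC.
have := dimvf 'rV['F_2]_m.+1.
by rewrite -CT C0 dimv0 dim_matrix mul1r.
Qed.
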